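(* Define the lattice $B$ of $W=k''$ by $$B=\begin{cases}\varpi''^{\mu}\mathcal{O}''&\text{if }k''\text{ is ramified over }k',\\ \varpi'^{[\frac{\mu+1}{2}]}\mathcal{O}''&\text{if }k''\text{ is unramified over }k'.\end{cases}$$ Then $B$ is a $T$-invariant good lattice, and it is self-dual if and only if $k''$ is ramified over $k'$ or $\mu$ is even. When $k''$ is unramified over $k'$ and $\mu$ is odd, $B^*=\varpi'^{-1}B$ and $\mathrm{b}^*=B^*/B=\mathcal{O}''/\varpi'\mathcal{O}''$ is a symplectic $\mathbb{F}_q$-vector space of dimension $\frac{2r}{e}$.
   Context: $k$ is a non-archimedean local field of characteristic $0$ with ring of integers $\mathcal{O}$, uniformizer $\varpi$, residue field $\mathbb{F}_q$ of characteristic $p\neq2$; $\psi$ is a non-trivial unitary character of $(k,+)$ with conductor $\lambda_\psi$ (trivial on $\varpi^{\lambda_\psi}\mathcal{O}$, not on $\varpi^{\lambda_\psi-1}\mathcal{O}$). $k'$ is an extension of $k$ of degree $r$, $k''$ a quadratic extension of $k'$, $\tau$ the non-trivial element of $\mathrm{Gal}(k''/k')$. $\mathcal{O}',\mathcal{O}''$ are the rings of integers, $\varpi',\varpi''$ uniformizers and $v',v''$ normalized valuations of $k',k''$; the uniformizers are chosen with $\varpi''^2=\varpi'$ if $k''/k'$ is ramified, $\varpi''=\varpi'$ if unramified. $u\in k''^\times$ has trace $0$ over $k'$, with $u=\varpi''$ if $k''/k'$ is ramified and $v''(u)\in\{0,1\}$ if unramified. $W$ is the $k$-space $k''$ with symplectic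 form $\beta(x,y)=\beta_u(x,y)=\frac12\mathrm{tr}_{k''/k}(u\,x^\tau y)$, and $T=\{t\in k''^\times:tt^\tau=1\}$ acts by multiplication (a maximal elliptic torus of $Sp(W)$ acting irreducibly). $e$ is the ramification index of $k'/k$, $\delta$ the integer such that $\varpi'^\delta\mathcal{O}'$ is the different of $k'/k$, and $\mu=e\lambda_\psi-\delta-v''(u)$. A lattice is a compact open $\mathcal{O}$-submodule of $W$; $B^*=\{v\in W:\beta(v,b)\in\varpi^{\lambda_\psi}\mathcal{O}\ \forall b\in B\}$; $B$ is good if $\varpi B^*\subset B\subset B^*$, self-dual if $B=B^*$. For a good lattice, $B^*/B$ carries the $\mathbb{F}_q$-symplectic form $\varpi^{1-\lambda_\psi}\beta\bmod\varpi$. $[\cdot]$ is the integer part. The identification $B^*/B=\mathcal{O}''/\varpi'\mathcal{O}''$ is by multiplication by a power of $\varpi'$. *)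

(* Defs.v *)
From HB Require Import structures.
From mathcomp Require Import all_boot all_order all_algebra all_field.
From mathcomp Require Import complex.
From mathcomp Require Import all_classical all_reals all_analysis.

Set Implicit Arguments.
Unset Strict Implicit.
Unset Printing Implicit Defensive.

Import Order.TTheory GRing.Theory Num.Theory.
Import numFieldNormedType.Exports.
Local Open Scope classical_set_scope.
Local Open Scope ring_scope.

(* Valuations are int-valued; the value at 0 is irrelevant junk, 0 standing  *)
(* for an element of valuation +oo wherever a valuation is tested.           *)
Section Valuation.
Variable F : fieldType.
Implicit Type v : F -> int.

Definition normalized_valuation v : Prop :=
  [/\ forall x y, x != 0 -> y != 0 -> v (x * y) = v x + v y,
      forall x y, x != 0 -> y != 0 -> x + y != 0 ->
        Num.min (v x) (v y) <= v (x + y)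
    & exists2 x, x != 0 & v x = 1].

Definition vge v (n : int) : set F := [set x | x = 0 \/ n <= v x].

Definition vring v : set F := vge v 0.

Definition uniformizer v (x : F) : Prop := x != 0 /\ v x = 1.

(* pi ^ n O *)
Definition pideal v (pi : F) (n : int) : set F :=
  [set pi ^ n * x | x in vring v].

Definition vball v (x : F) (n : int) : set F := [set y | vge v n (y - x)].

Definition vcomplete v : Prop :=
  forall s : nat -> F,
    (forall n : int, exists N : nat, forall i j : nat,
       (N <= i)%N -> (N <= j)%N -> vge v n (s i - s j)) ->
  exists l : F,
    forall n : int, exists N : nat, forall i : nat,
       (N <= i)%N -> vge v n (s i - l).

Definition vopen v (U : set F) : Prop :=
  forall x, U x -> exists n : int, vball v x n `<=` U.

End Valuation.

(* The field F with the topology defined by v.                               *)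
Definition vtop (F : fieldType) (v : F -> int) : Type := F.

HB.instance Definition _ (F : fieldType) (v : F -> int) :=
  Choice.copy (vtop v) F.

Section ValuationTopology.
Variables (F : fieldType) (v : F -> int).

Let vopenT : vopen v setT.
Proof. by move=> x _; exists 0. Qed.

Let vopenI : setI_closed (vopen v).
Proof.
move=> A B oA oB x [/oA[m mA] /oB[n nB]].
exists (Num.max m n) => y [|]; first by move=> e; split; [apply: mA|apply: nB]; left.
by rewrite ge_max => /andP[my ny]; split; [apply: mA|apply: nB]; right.
Qed.

Let vopen_bigU (I : Type) (f : I -> set F) :
  (forall i, vopen v (f i)) -> vopen v (\bigcup_i f i).
Proof.
move=> fo x [i _ fix_]; have [n nf] := fo i x fix_.
by exists n => y /nf fiy; exists i.
Qed.

HB.instance Definition _ :=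
  isOpenTopological.Build (vtop v) vopenT vopenI vopen_bigU.

End ValuationTopology.

(* Fq is the residue field of v: red induces a ring isomorphism O / p = Fq   *)
(* (the values of red outside O are junk).                                   *)
Definition residue_map (F : fieldType) (v : F -> int) (Fq : finFieldType)
    (red : F -> Fq) : Prop :=
  [/\ red 1 = 1,
      forall x y, vring v x -> vring v y -> red (x + y) = red x + red y,
      forall x y, vring v x -> vring v y -> red (x * y) = red x * red y,
      forall a, exists2 x, vring v x & red x = a
    & forall x, vring v x -> (red x = 0 <-> vge v 1 x)].

Definition local_field_char0 (F : fieldType) (v : F -> int)
    (Fq : finFieldType) (red : F -> Fq) : Prop :=
  [/\ [pchar F] =i pred0, normalized_valuation v, vcomplete v
    & residue_map v red].

Definition unitary_character (R : realType) (F : fieldType) (v : F -> int)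
    (psi : F -> R[i]) : Prop :=
  [/\ forall x y, psi (x + y) = psi x * psi y,
      forall x, `|psi x| = 1
    & continuous (psi : vtop v -> (R[i] : numFieldType))].

Definition conductor (R : realType) (F : fieldType) (v : F -> int) (pi : F)
    (psi : F -> R[i]) (lambda : int) : Prop :=
  (forall x, pideal v pi lambda x -> psi x = 1) /\
  (exists2 x, pideal v pi (lambda - 1) x & psi x <> 1).

Section Extension.
Variables (F : fieldType) (L : fieldExtType F).

Definition ext_trace (x : L) : F :=
  \sum_(i < \dim {:L}) coord (vbasis {:L}) i (x * (vbasis {:L})`_i).

(* w extends v up to normalization, with ramification index e. *)
Definition ramification_index (v : F -> int) (w : L -> int) (e : nat) : Prop :=
  (0 < e)%N /\ forall x : F, x != 0 -> w x%:A = e%:Z * v x.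

Definition codifferent (v : F -> int) (w : L -> int) : set L :=
  [set x | forall y, vring w y -> vring v (ext_trace (x * y))].

(* The inverse of the fractional ideal codifferent. *)
Definition different (v : F -> int) (w : L -> int) : set L :=
  [set y | forall x, codifferent v w x -> vring w (y * x)].

End Extension.

Section Torus.
Variables (k : fieldType) (k1 : fieldExtType k) (k2 : fieldExtType k1).
Variables (v : k -> int) (v2 : k2 -> int).

(* baseFieldType k2 is k2 viewed as an extension of k. *)
Local Notation W := (baseFieldType k2).

Definition beta (tau : k2 -> k2) (u : k2) (x y : W) : k :=
  2^-1 * ext_trace (u * tau x * y : W).

Definition torus (tau : k2 -> k2) : set k2 := [set t | t * tau t = 1].

Definition lattice (B : set W) : Prop :=
  [/\ [/\ B 0, forall x y, B x -> B y -> B (x + y)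
        & forall (a : k) x, vring v a -> B x -> B (a *: x)],
      compact (B : set (vtop v2))
    & open (B : set (vtop v2))].

Definition dual_lattice (pi : k) (lambda : int) (b : W -> W -> k) (B : set W) :
    set W :=
  [set x | forall y, B y -> pideal v pi lambda (b x y)].

Definition good_lattice (pi : k) (lambda : int) (b : W -> W -> k) (B : set W) :
    Prop :=
  [/\ lattice B,
      [set pi *: x | x in dual_lattice pi lambda b B] `<=` B
    & B `<=` dual_lattice pi lambda b B].

(* pr induces an isomorphism of A / B with the Fq-vector space V, the scalar *)
(* red a acting on A / B as a does (the values of pr outside A are junk).    *)
Definition quotient_map (Fq : finFieldType) (red : k -> Fq) (A B : set W)
    (V : lmodType Fq) (pr : W -> V) : Prop :=
  [/\ forall x y, A x -> A y -> pr (x + y) = pr x + pr y,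
      forall a x, vring v a -> A x -> pr (a *: x) = red a *: pr x,
      forall w, exists2 x, A x & pr x = w
    & forall x, A x -> (pr x = 0 <-> B x)].

Definition torus_lattice (pi1 : k1) (pi2 : k2) (ramified : bool) (mu : int) :
    set W :=
  if ramified then pideal v2 pi2 mu else pideal v2 pi1%:A ((mu + 1) %/ 2)%Z.

End Torus.

(* Main.v *)
(* For a finite extension L of a complete discretely valued field F with      *)
(* valuation ring O, lift a basis of the residue field of L: multiplied by the *)
(* powers varpi^j, j < e, the lifts form, by successive approximation, a basis *)
(* of O_L over O. Hence e f = [L : F]; O_L is bounded in coordinates, so every *)
(* F-automorphism of L preserves the valuation; and, the residue field being   *)
(* finite, the ideals of O_L are compact.                                      *)
(*   On W = k'', beta(x, y) = tr_{k'/k} (tr_{k''/k'} (u x^tau y)) / 2. The     *)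
(* codifferent of k'/k is given by delta, and that of k''/k' is                *)
(* {v'' >= 1 - e''} because k''/k' is tame. So the dual of the ideal           *)
(* {v'' >= m} is {v'' >= M - m} with M = e'' (e lambda - delta) + 1 - e'' -    *)
(* v''(u), that is M = 2 mu if k''/k' is ramified and M = mu otherwise.        *)

Require Import Defs.
From HB Require Import structures.
From mathcomp Require Import all_boot all_order all_algebra all_field.
From mathcomp Require Import complex.
From mathcomp Require Import all_classical all_reals all_analysis.
From mathcomp Require Import zify ring.

Import Order.TTheory GRing.Theory Num.Theory.
Import numFieldNormedType.Exports.
Local Open Scope classical_set_scope.
Local Open Scope ring_scope.

(** * Discrete valuations *)

(** Every lattice involved is an ideal [vge v2 m] of [k2], so the theorem reduces to arithmetic of
    indices. By [dual_vge] duality sends the index m to M - m, where M = e2 (e lambda - delta) + 1 -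
    e2 - v2 u. Hence the ideal of index m is self-dual exactly when M = 2 m, and it is good when M
    <= 2 m <= M + e e2 ([good_vge]). If [k2] is ramified, M = 2 mu and B has index mu. If not, M =
    mu and the index [(mu + 1) / 2] of B gives 2 m = M for mu even and 2 m = M + 1 for mu odd; in
    the odd case the dual is one step larger than B. The torus preserves every ideal because its
    elements have valuation 0 ([torus_vge]).

    The formula for the dual comes from transitivity of the trace ([ext_trace_base]), which
    separates the contribution of [k1] over [k], read off from the different ([trace_codifferent]),
    from that of [k2] over [k1] ([quadratic_codifferent]). The latter relies on [val_tau]: the
    conjugation preserves the valuation.

    For the quotient, [residue_quotient] identifies consecutive ideals modulo each other with a
    space over the residue field, whose dimension is given by the relation between degree,
    ramification and residue degree. The scaled form descends and is nondegenerate because, in the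
    odd case, the two ideals are dual to each other ([symplectic_quotient]). Compactness of ideals,
    the degree relation and the invariance of the valuation all rest on one integral basis, built
    from lifted residues and powers of a uniformizer. *)

Section Valuations.
Context {F : fieldType} {v : F -> int}.
Hypothesis hv : normalized_valuation v.

Lemma valuationM {x y} : x != 0 -> y != 0 -> v (x * y) = v x + v y.
Proof. by case: hv => + _ _; apply. Qed.

Lemma valuation1 : v 1 = 0.
Proof.
have := valuationM (oner_neq0 F) (oner_neq0 F).
by rewrite mulr1 => /eqP; rewrite -subr_eq subrr eq_sym => /eqP.
Qed.

Lemma valuationN x : v (- x) = v x.
Proof.
have [->|x0] := eqVneq x 0; first by rewrite oppr0.
have N1 : -1 != 0 :> F by rewrite oppr_eq0 oner_neq0.
rewrite -mulN1r valuationM //.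
suff -> : v (-1) = 0 by rewrite add0r.
by have := valuationM N1 N1; rewrite mulrNN mulr1 valuation1; lia.
Qed.

Lemma valuationV {x} : x != 0 -> v x^-1 = - v x.
Proof.
move=> x0; have := valuationM x0 (invr_neq0 x0).
by rewrite mulfV // valuation1; lia.
Qed.

Lemma valuationXn {x} n : x != 0 -> v (x ^+ n) = n%:Z * v x.
Proof.
move=> x0; elim: n => [|n IH]; first by rewrite expr0 valuation1 mul0r.
by rewrite exprS valuationM ?expf_neq0 // IH; lia.
Qed.

Lemma valuationXz {x} (n : int) : x != 0 -> v (x ^ n) = n * v x.
Proof.
move=> x0; case: n => n; first by rewrite -exprnP valuationXn.
by rewrite NegzE -exprnN valuationV ?expf_neq0 // valuationXn //; lia.
Qed.

Lemma vge0 n : vge v n 0. Proof. by left. Qed.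

Lemma vge_neq0 {n x} : x != 0 -> (vge v n x <-> n <= v x).
Proof. by move=> /eqP x0; split=> [[|//]|]; [move=> /x0 | right]. Qed.

Lemma vgeW {m n x} : n <= m -> vge v m x -> vge v n x.
Proof. by move=> nm [->|mx]; [left | right; apply: le_trans mx]. Qed.

Lemma vgeN {n x} : vge v n x -> vge v n (- x).
Proof. by case=> [->|nx]; [left; rewrite oppr0|right; rewrite valuationN]. Qed.

Lemma vgeD {n x y} : vge v n x -> vge v n y -> vge v n (x + y).
Proof.
move=> nx ny; have [xy0|xy0] := eqVneq (x + y) 0; first by left.
have [x0|x0] := eqVneq x 0; first by rewrite x0 add0r.
have [y0|y0] := eqVneq y 0; first by rewrite y0 addr0.
move/(vge_neq0 x0) : nx => nx; move/(vge_neq0 y0) : ny => ny; right.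
by case: hv => _ + _ => /(_ _ _ x0 y0 xy0); apply: le_trans; rewrite le_min nx.
Qed.

Lemma vgeB {n x y} : vge v n x -> vge v n y -> vge v n (x - y).
Proof. by move=> nx /vgeN; apply: vgeD. Qed.

Lemma vgeM {m n x y} : vge v m x -> vge v n y -> vge v (m + n) (x * y).
Proof.
have [->|x0] := eqVneq x 0; first by rewrite mul0r; left.
have [->|y0] := eqVneq y 0; first by rewrite mulr0; left.
by move=> /(vge_neq0 x0) mx /(vge_neq0 y0) ny; right; rewrite valuationM // lerD.
Qed.

Lemma vge_sum n I (r : seq I) (P : pred I) (f : I -> F) :
  (forall i, P i -> vge v n (f i)) -> vge v n (\sum_(i <- r | P i) f i).
Proof. by apply: big_ind; [exact: vge0 | exact: @vgeD]. Qed.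

Lemma vge_mull {n x y} : x != 0 -> (vge v (v x + n) (x * y) <-> vge v n y).
Proof.
move=> x0; have [->|y0] := eqVneq y 0; first by rewrite mulr0; split; left.
by rewrite (vge_neq0 y0) (vge_neq0 (mulf_neq0 x0 y0)) valuationM // lerD2l.
Qed.

Lemma vring1 : vring v 1. Proof. by right; rewrite valuation1. Qed.

Lemma vge_separated {x} : (forall n : nat, vge v n x) -> x = 0.
Proof.
move=> h; apply/eqP; apply/negPn/negP => x0.
by have /(vge_neq0 x0) := h (`|v x|%N.+1); lia.
Qed.

Lemma uniformizerX_neq0 { pi : F} (n : int) : uniformizer v pi -> pi ^ n != 0.
Proof. by case=> pi0 _; rewrite expfz_neq0. Qed.

Lemma val_uniformizerX { pi : F} (n : int) : uniformizer v pi -> v (pi ^ n) = n.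
Proof. by case=> pi0 pi1; rewrite valuationXz // pi1 mulr1. Qed.

Lemma vge_uniformizer { pi : F} (n m : int) {x} : uniformizer v pi ->
  vge v (n + m) (pi ^ n * x) <-> vge v m x.
Proof.
move=> hpi; rewrite -[X in X + m](val_uniformizerX _ hpi).
exact/vge_mull/uniformizerX_neq0.
Qed.

Lemma pideal_vge { pi : F} (n : int) : uniformizer v pi -> pideal v pi n = vge v n.
Proof.
move=> hpi; apply/seteqP; split=> x /=.
  by case=> y hy <-; rewrite -[X in vge v X]addr0; apply/(vge_uniformizer _ _ hpi).
move=> hx; exists (pi ^ (- n) * x).
  by rewrite /vring -[X in vge v X](addNr n); apply/(vge_uniformizer _ _ hpi).
by rewrite mulrA -expfzDr ?(proj1 hpi) // subrr expr0z mul1r.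
Qed.

Lemma complete_series { pi : F} (a : nat -> F) :
  vcomplete v -> uniformizer v pi -> (forall n, vring v (a n)) ->
  exists2 l, vring v l &
    forall N : nat, vge v N (l - \sum_(n < N) pi ^+ n * a n).
Proof.
move=> cv hpi ha; pose s N := \sum_(n < N) pi ^+ n * a n.
have s_near (N i : nat) : (N <= i)%N -> vge v N (s i - s N).
  move=> Ni; rewrite /s -!(big_mkord xpredT (fun n => pi ^+ n * a n)).
  rewrite (big_cat_nat (leq0n N) Ni) /= addrAC subrr add0r big_nat.
  apply: vge_sum => j /andP[Nj _]; apply: (@vgeW j); first by lia.
  by rewrite -[X in vge v X]addr0 exprnP; apply/(vge_uniformizer _ _ hpi); exact: ha.
have [] := cv s.
  move=> n; exists `|n|%N => i j /s_near ni /s_near nj.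
  rewrite (_ : s i - s j = (s i - s `|n|%N) - (s j - s `|n|%N)); last by ring.
  by apply: (@vgeW `|n|%N); [lia | exact: vgeB].
move=> l hl.
have near_l (N : nat) : vge v N (l - s N).
  have [M hM] := hl N.
  rewrite (_ : l - s N = (s (maxn M N) - s N) - (s (maxn M N) - l)); last by ring.
  by apply: vgeB; [apply/s_near/leq_maxr | apply/hM/leq_maxl].
by exists l => //; have := near_l 0%N; rewrite /s big_ord0 subr0.
Qed.

End Valuations.

(** * Finite extensions of complete fields *)

Section Extensions.
Context {F : fieldType} {L : fieldExtType F} {v : F -> int} {w : L -> int}.
Context {e : nat} { pi : F} {varpi : L}.
Hypothesis hv : normalized_valuation v.
Hypothesis hw : normalized_valuation w.
Hypothesis he : ramification_index v w e.
Hypothesis hpi : uniformizer v pi.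
Hypothesis hvarpi : uniformizer w varpi.

Lemma vgeZ {m n : int} {a x} : vge v m a -> vge w n x ->
  vge w (e%:Z * m + n) (a *: x).
Proof.
have [->|a0] := eqVneq a 0; first by rewrite scale0r; left.
move=> /(vge_neq0 a0) ma nx; rewrite -mulr_algl; apply: (vgeM hw) nx.
by right; case: he => _ ->; rewrite // ler_wpM2l.
Qed.

Lemma vge_scale_unif {n : nat} {m : int} {x} :
  vge w ((e * n)%N%:Z + m) (pi ^+ n *: x) <-> vge w m x.
Proof.
have pn0 : (pi ^+ n)%:A != 0 :> L.
  by rewrite scaler_eq0 oner_eq0 orbF expf_neq0 // (proj1 hpi).
rewrite -mulr_algl -[X in _ <-> X](vge_mull hw pn0) (proj2 he); last first.
  by rewrite expf_neq0 // (proj1 hpi).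
by rewrite (valuationXn hv) ?(proj1 hpi) // (proj2 hpi) mulr1 PoszM.
Qed.

(** Linear independence modulo an ideal of [L], phrased without quotients. It is used for m = 1, the
    residue field of [L], and for m = e, the ring of integers of [L] modulo [pi]. *)
Definition residually_free {I : finType} (m : nat) (z : I -> L) : Prop :=
  forall a : I -> F, (forall i, vring v (a i)) ->
    vge w m (\sum_i a i *: z i) -> forall i, vge v 1 (a i).

Definition residually_spanning {I : finType} (m : nat) (z : I -> L) : Prop :=
  forall x, vring w x -> exists2 a : I -> F, (forall i, vring v (a i)) &
    vge w m (x - \sum_i a i *: z i).

(** Dividing a nontrivial relation by a coefficient of least valuation makes all coefficients
    integral and one of them equal to 1, against residual freeness. *)
Lemma residually_free_eq0 {I : finType} {m} {z : I -> L} {a : I -> F} :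
  residually_free m z -> \sum_i a i *: z i = 0 -> forall i, a i = 0.
Proof.
move=> fz s0 i; apply/eqP; apply: contraT => ai0.
pose i0 := [arg min_(j < i | a j != 0) v (a j)]%O.
have [j aj0 jmin] : exists2 j, a j != 0 & forall l, a l != 0 -> v (a j) <= v (a l).
  by exists i0; rewrite /i0; case: arg_minP.
suff bO l : vring v ((a j)^-1 * a l).
  have /(fz _ bO)/(_ j) : vge w m (\sum_l ((a j)^-1 * a l) *: z l).
    under eq_bigr do rewrite -scalerA.
    by rewrite -scaler_sumr s0 scaler0; left.
  by rewrite mulVf // (vge_neq0 (oner_neq0 F)) (valuation1 hv).
have [->|al0] := eqVneq (a l) 0; first by rewrite mulr0; left.
right; rewrite (valuationM hv) ?invr_eq0 // (valuationV hv) //.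
by have := jmin l al0; lia.
Qed.

Lemma residually_free_linfree {I : finType} {m} {z : I -> L} :
  residually_free m z -> free [tuple of [seq z (enum_val i) | i <- ord_tuple #|I|]].
Proof.
move=> fz; apply/freeP => a s0 i.
have: \sum_j a (enum_rank j) *: z j = 0.
  rewrite -[RHS]s0 (reindex (@enum_val I I)) /=; last first.
    by exists enum_rank => j _; [exact: enum_valK | exact: enum_rankK].
  apply: eq_bigr => j _; rewrite enum_valK.
  by rewrite (nth_map j) ?size_enum_ord // nth_ord_enum.
by move/(residually_free_eq0 fz)/(_ (enum_val i)); rewrite enum_valK.
Qed.

Lemma residually_free_card {I : finType} {m} {z : I -> L} :
  residually_free m z -> (#|I| <= \dim {:L})%N.
Proof.
move=> /residually_free_linfree; move: [tuple of _] => X /eqP.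
by rewrite size_tuple => <-; exact/dimvS/subvf.
Qed.

(** Residually free families have at most [L : F] members, so one of maximal size exists. If it is
    extended by an integral x, a relation with unit coefficient at x would express x through the
    family; a family missing x would thus have a larger free extension. *)
Lemma residual_basis_exists : exists (d : nat) (z : 'I_d -> L),
  [/\ forall i, vring w (z i), residually_free 1 z & residually_spanning 1 z].
Proof.
pose P d := `[< exists2 z : 'I_d -> L,
  forall i, vring w (z i) & residually_free 1 z >].
have P0 : exists d, P d.
  by exists 0%N; apply/asboolP; exists (fun=> 0) => [[]|? _ _ []].
have Pb d : P d -> (d <= \dim {:L})%N.
  by move=> /asboolP[z _ /residually_free_card]; rewrite card_ord.
case: (ex_maxnP P0 Pb) => d /asboolP[z zO fz] dmax; exists d, z; split=> // x xO.
pose z' (i : 'I_d.+1) := if unlift ord0 i is Some j then z j else x.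
apply: contrapT => nspan.
suff: P d.+1 by move/dmax; rewrite ltnn.
apply/asboolP; exists z' => [i|a aO].
  by rewrite /z'; case: unliftP => [j _|_]; [exact: zO | exact: xO].
rewrite big_ord_recl /z' unlift_none.
under eq_bigr do rewrite liftK.
move=> h.
have a01 : vge v 1 (a ord0).
  apply: contrapT => na01; apply: nspan.
  have a00 : a ord0 != 0 by apply/eqP => a00; apply: na01; left.
  have va0 : v (a ord0) = 0.
    move: na01; rewrite (vge_neq0 a00); have := aO ord0.
    by rewrite /vring (vge_neq0 a00); lia.
  have V0 : vring v (a ord0)^-1 by right; rewrite (valuationV hv) // va0.
  exists (fun i => - ((a ord0)^-1 * a (lift ord0 i))) => [i|].
    exact/(vgeN hv)/(vgeM hv V0 (aO _)).
  have := vgeZ V0 h; rewrite mulr0 add0r scalerDr scalerA mulVf // scale1r.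
  rewrite -sumrN scaler_sumr.
  by under [in X in _ -> X]eq_bigr do rewrite scaleNr opprK -scalerA.
have /fz h2 : vge w 1%N (\sum_(i < d) a (lift ord0 i) *: z i).
  have := vgeB hw h (vgeW _ (vgeZ a01 xO)).
  by rewrite [X in X - _]addrC addrK; apply; case: he; lia.
move=> i; case: (unliftP ord0 i) => [j ->|-> //].
by apply: h2 => j'; exact: aO.
Qed.

(** * Digit expansions along powers of a uniformizer of [L] *)

Section ResidualBasis.
Context {d : nat} {z : 'I_d -> L}.
Hypothesis zO : forall i, vring w (z i).
Hypothesis fz : residually_free 1 z.
Hypothesis sz : residually_spanning 1 z.

Lemma sum_vring {I : finType} {a : I -> F} {y : I -> L} :
  (forall i, vring v (a i)) -> (forall i, vring w (y i)) ->
  vring w (\sum_i a i *: y i).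
Proof.
move=> aO yO; apply: (vge_sum hw) => i _.
by have := vgeZ (aO i) (yO i); rewrite mulr0 addr0.
Qed.

Lemma residual_expansion (n : nat) x : vring w x ->
  exists2 a : nat -> 'I_d -> F, forall j i, vring v (a j i) &
    vge w n (x - \sum_(j < n) varpi ^+ j * \sum_i a j i *: z i).
Proof.
move=> xO; elim: n => [|n [a aO han]].
  by exists (fun _ _ => 0) => [j i|]; [left | rewrite big_ord0 subr0].
set rho := x - _ in han.
have rO : vring w (varpi ^ (- n%:Z) * rho).
  by rewrite /vring -[X in vge w X](addNr n%:Z); apply/(vge_uniformizer hw _ _ hvarpi).
have [b bO hb] := sz _ rO.
exists (fun j => if j == n then b else a j) => [j i|]; first by case: ifP.
rewrite big_ord_recr /= eqxx opprD addrA.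
rewrite (_ : x - _ = rho); last first.
  by congr (_ - _); apply: eq_bigr => j _; rewrite ltn_eqF.
move: hb; rewrite -(vge_uniformizer hw n _ hvarpi) mulrBr mulrA.
by rewrite -expfzDr ?(proj1 hvarpi) // subrr expr0z mul1r -PoszD addn1.
Qed.

(** Digits are shown to vanish residually one at a time. Once the digits below n lie in the maximal
    ideal of [F], their terms have valuation at least j + e, which exceeds n as long as n < e; the
    digit at n is then isolated. *)
Lemma residual_expansion_free (n : nat) (a : nat -> 'I_d -> F) :
  (n <= e)%N -> (forall j i, vring v (a j i)) ->
  vge w n (\sum_(j < n) varpi ^+ j * \sum_i a j i *: z i) ->
  forall j i, (j < n)%N -> vge v 1 (a j i).
Proof.
move=> + aO; elim: n => [//|n IH] ne; rewrite big_ord_recr /=.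
set s := \sum_(j < n) _; set t := \sum_i _ => h.
have tO : vring w t by apply: sum_vring.
have sn : vge w n s.
  have tn : vge w n (varpi ^+ n * t).
    by rewrite -[X in vge w X]addr0; apply/(vge_uniformizer hw _ _ hvarpi).
  by have := vgeB hw (vgeW _ h) tn; rewrite addrK; apply; lia.
have an := IH (ltnW ne) sn.
have sn1 : vge w n.+1 s.
  apply: (vge_sum hw) => j _; apply: (@vgeW _ _ (j%:Z + e%:Z)); first by lia.
  apply/(vge_uniformizer hw _ _ hvarpi); apply: (vge_sum hw) => i _.
  by have := vgeZ (an j i (ltn_ord j)) (zO i); rewrite mulr1 addr0.
have := vgeB hw h sn1; rewrite addrAC subrr add0r.
have -> : n.+1%:Z = n%:Z + 1%N by lia.
move=> /(vge_uniformizer hw _ _ hvarpi) /(fz _ (aO n)) ann j i.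
by rewrite ltnS leq_eqVlt => /predU1P[->|]; [exact: ann | exact: an].
Qed.

Definition integral_basis (ji : 'I_e * 'I_d) : L := varpi ^+ ji.1 * z ji.2.

Lemma integral_basis_sum (a : 'I_e * 'I_d -> F) :
  \sum_ji a ji *: integral_basis ji =
  \sum_(j < e) varpi ^+ j * \sum_i a (j, i) *: z i.
Proof.
under [RHS]eq_bigr do rewrite mulr_sumr.
by rewrite pair_big /=; apply: eq_bigr => -[j i] _; rewrite scalerAr.
Qed.

Lemma integral_basis_vring ji : vring w (integral_basis ji).
Proof.
apply: (vgeW (_ : 0 <= ji.1%:Z + 0)) => //.
by rewrite /integral_basis exprnP; apply/(vge_uniformizer hw _ _ hvarpi)/zO.
Qed.

Lemma integral_basis_free : residually_free e integral_basis.
Proof.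
move=> a aO; rewrite integral_basis_sum.
pose a' (j : nat) i := if insub j is Some j' then a (j', i) else 0.
have a'O j i : vring v (a' j i) by rewrite /a'; case: insub => [?|]; [exact: aO | left].
rewrite (eq_bigr (fun j : 'I_e => varpi ^+ j * \sum_i a' j i *: z i)); last first.
  by move=> j _; rewrite /a' valK.
move=> /(residual_expansion_free _ _ (leqnn e) a'O) + [j i] => /(_ j i (ltn_ord j)).
by rewrite /a' valK.
Qed.

Lemma integral_basis_spanning : residually_spanning e integral_basis.
Proof.
move=> x /(residual_expansion e)[a aO ha].
by exists (fun ji : 'I_e * 'I_d => a ji.1 ji.2) => [ji|]; rewrite ?integral_basis_sum.
Qed.

End ResidualBasis.

(** * Completeness turns bases modulo [pi] into integral bases *)

Section Complete.
Hypothesis cv : vcomplete v.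
Context {I : finType} {z : I -> L}.
Hypothesis zO : forall i, vring w (z i).
Hypothesis fz : residually_free e z.
Hypothesis sz : residually_spanning e z.

Lemma integral_series (a : nat -> I -> F) : (forall n i, vring v (a n i)) ->
  exists2 l : I -> F, forall i, vring v (l i) &
    forall N : nat, vge w (e * N)%N
      (\sum_i l i *: z i - \sum_(n < N) pi ^+ n *: \sum_i a n i *: z i).
Proof.
move=> aO.
have /choice[l hl] i : exists l, vring v l /\
    forall N : nat, vge v N (l - \sum_(n < N) pi ^+ n * a n i).
  by have [l] := complete_series hv (a^~ i) cv hpi (aO^~ i); exists l.
exists l => [i|N]; first exact: (hl i).1.
under [X in _ - X]eq_bigr do rewrite scaler_sumr.
rewrite exchange_big /= -sumrB; apply: (vge_sum hw) => i _.
under eq_bigr do rewrite scalerA.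
rewrite -scaler_suml -scalerBl.
by have := vgeZ ((hl i).2 N) (zO i); rewrite addr0 PoszM.
Qed.

(** Successive approximation: spanning modulo [pi] writes x as a combination of [z] plus [pi] times
    an integral remainder. Iterating on the remainder gives a [pi]-adic series in each coordinate,
    and these converge in [F]. *)
Lemma integral_coordinates x : vring w x ->
  exists2 a : I -> F, forall i, vring v (a i) & x = \sum_i a i *: z i.
Proof.
move=> xO.
have /choice[f hf] (y : L) : exists ay : (I -> F) * L, vring w y ->
    [/\ forall i, vring v (ay.1 i), vring w ay.2
      & y = \sum_i ay.1 i *: z i + pi *: ay.2].
  have [/sz[a aO ha]|] := pselect (vring w y); last by exists (fun=> 0, 0).
  exists (a, pi^-1 *: (y - \sum_i a i *: z i)) => _; split=> //=.
    apply/(@vge_scale_unif 1); rewrite muln1 addr0 expr1 scalerA.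
    by rewrite mulfV ?scale1r // (proj1 hpi).
  by rewrite scalerA mulfV ?(proj1 hpi) // scale1r subrKC.
pose y n := iter n (fun t => (f t).2) x.
have yO n : vring w (y n) by elim: n => //= n /hf[].
have xE N : x = \sum_(n < N) pi ^+ n *: (\sum_i (f (y n)).1 i *: z i) +
    pi ^+ N *: y N.
  elim: N => [|N IH]; first by rewrite big_ord0 add0r scale1r.
  rewrite big_ord_recr /= -addrA {1}IH; congr (_ + _).
  have [_ _ {1}->] := hf _ (yO N).
  by rewrite scalerDr scalerA -exprSr.
have fO n i : vring v ((f (y n)).1 i) by have [] := hf _ (yO n).
have [a aO ha] := integral_series (fun n => (f (y n)).1) fO.
exists a => //; apply/eqP; rewrite -subr_eq0; apply/eqP/(vge_separated) => N.
apply: (@vgeW _ _ (e * N)%N); first by case: he; nia.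
rewrite [X in X - _](xE N).
have := vgeB hw (_ : vge w (e * N)%N (pi ^+ N *: y N)) (ha N).
rewrite opprB addrA [_ + \sum_(_ < _) _]addrC; apply.
by have /(@vge_scale_unif N) := yO N; rewrite addr0.
Qed.

(** Freeness gives one inequality. For the other, a power of [pi] brings any element of [L] into the
    ring of integers, so [z] spans [L]. *)
Lemma card_integral_basis : #|I| = \dim {:L}.
Proof.
apply/eqP; rewrite eqn_leq (residually_free_card fz) /=.
pose X := [tuple of [seq z (enum_val i) | i <- ord_tuple #|I|]].
suff: ({:L} <= <<X>>)%VS.
  move=> /dimvS /leq_trans; apply.
  by rewrite -[X in (_ <= X)%N](size_tuple X) dim_span.
apply/subvP => x _.
have [n nO] : exists n : nat, vring w (pi ^+ n *: x).
  exists `|w x|%N.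
  have [->|x0] := eqVneq x 0; first by rewrite scaler0; left.
  have wx : vge w (- `|w x|%N%:Z) x by right; lia.
  apply: (vgeW _ (proj2 (@vge_scale_unif `|w x|%N _ _) wx)).
  by case: he; nia.
have [a _ ax] := integral_coordinates _ nO.
have -> : x = pi ^- n *: (pi ^+ n *: x).
  by rewrite scalerA mulVf ?scale1r // expf_neq0 // (proj1 hpi).
rewrite ax; apply/memvZ/memv_suml => i _; apply/memvZ/memv_span.
apply/mapP; exists (enum_rank i); first by rewrite mem_enum.
by rewrite enum_rankK.
Qed.

Lemma extension_series (y : nat -> L) : (forall n, vring w (y n)) ->
  exists2 l : L, vring w l &
    forall N : nat, vge w (e * N)%N (l - \sum_(n < N) pi ^+ n *: y n).
Proof.
move=> yO.
have /choice[a ha] n : exists a : I -> F,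
    (forall i, vring v (a i)) /\ y n = \sum_i a i *: z i.
  by have [a] := integral_coordinates _ (yO n); exists a.
have [l lO hl] := integral_series a (fun n => (ha n).1).
exists (\sum_i l i *: z i) => [|N].
  by apply: (vge_sum hw) => i _; have := vgeZ (lO i) (zO i); rewrite mulr0 addr0.
rewrite (eq_bigr (fun n : 'I_N => pi ^+ n *: \sum_i a n i *: z i)) //.
by move=> n _; rewrite (ha n).2.
Qed.

(* [s] is bounded below on [O_L]; applied to powers, this gives [w (s x) >= 0]. *)
Lemma valuation_automorphism_of_basis (s : L -> L) :
  (forall x y, s (x + y) = s x + s y) -> (forall x y, s (x * y) = s x * s y) ->
  (forall a x, s (a *: x) = a *: s x) -> s 1 = 1 ->
  forall x, w (s x) = w x.
Proof.
move=> sD sM sZ s1.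
have s0 : s 0 = 0 by have := sZ 0 0; rewrite !scale0r.
have s_neq0 x : x != 0 -> s x != 0.
  move=> x0; have := sM x x^-1; rewrite mulfV // s1 => /esym h.
  by apply: contra_eq_neq h => ->; rewrite mul0r eq_sym oner_eq0.
have sX x n : s (x ^+ n) = s x ^+ n by elim: n => // n IH; rewrite !exprS sM IH.
have [C hC] : exists C : nat, forall x, vring w x -> vge w (- C%:Z) (s x).
  exists (\max_i `|w (s (z i))|)%N => x /integral_coordinates[a aO ->].
  have -> : s (\sum_i a i *: z i) = \sum_i a i *: s (z i).
    by rewrite (big_morph s sD s0); apply: eq_bigr => i _; rewrite sZ.
  apply: (vge_sum hw) => i _.
  rewrite -[X in vge w X]add0r -[X in vge w (X + _)](mulr0 e%:Z).
  apply: vgeZ (aO i) _; right.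
  by have := leq_bigmax (F := fun i => `|w (s (z i))|%N) i; lia.
have ge0 x : x != 0 -> 0 <= w x -> 0 <= w (s x).
  move=> x0 wx.
  have /hC : vring w (x ^+ C.+1) by right; rewrite (valuationXn hw) //; nia.
  by rewrite sX (vge_neq0 (expf_neq0 _ (s_neq0 _ x0))) (valuationXn hw) ?s_neq0 //; nia.
have unit0 x : x != 0 -> w x = 0 -> w (s x) = 0.
  move=> x0 wx; have := ge0 x x0; have := ge0 x^-1 (invr_neq0 x0).
  rewrite (valuationV hw) // wx oppr0 => /(_ (lexx _)) h1 /(_ (lexx _)) h2.
  have := valuationM hw (s_neq0 _ x0) (s_neq0 _ (invr_neq0 x0)).
  by rewrite -sM mulfV // s1 (valuation1 hw); lia.
(* Each x is a unit times [varpi ^ w x], and [s] sends units to units. *)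
have scale_unif x : x != 0 -> w (s x) = w x * w (s varpi).
  move=> x0; have v0 := proj1 hvarpi.
  have wx0 := expfz_neq0 (w x) v0.
  have := unit0 (x * varpi ^ (- w x)).
  rewrite mulf_neq0 ?expfz_neq0 // (valuationM hw) ?expfz_neq0 // (valuationXz hw) //.
  rewrite (proj2 hvarpi) mulr1 subrr => /(_ isT erefl).
  have sXz n : s (varpi ^ n) = s varpi ^ n.
    case: n => n; first exact: sX.
    rewrite NegzE -!exprnN -sX; apply: (mulfI (s_neq0 _ (expf_neq0 n.+1 v0))).
    by rewrite -sM !mulfV ?s_neq0 ?expf_neq0.
  by rewrite sM sXz (valuationM hw) ?expfz_neq0 ?s_neq0 // (valuationXz hw) ?s_neq0 //; nia.
(* [s] fixes [pi], whose valuation in [L] is e; comparing gives e = e * w (s varpi). *)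
have sv1 : w (s varpi) = 1.
  have pi0 : pi%:A != 0 :> L by rewrite scaler_eq0 oner_eq0 orbF (proj1 hpi).
  have := scale_unif _ pi0; rewrite sZ s1 (proj2 he) ?(proj1 hpi) // (proj2 hpi).
  by case: he; nia.
move=> x; have [->|x0] := eqVneq x 0; first by rewrite s0.
by rewrite scale_unif // sv1 mulr1.
Qed.

End Complete.

(** * Consequences of a finite residue field: compact ideals and residue quotients *)

Lemma ultra_finite_cover {T : Type} {G : set_system T} {J : finType}
    {A : J -> set T} : UltraFilter G ->
  G [set x | exists j, A j x] -> exists j, G (A j).
Proof.
move=> GU GA; apply: contrapT => nA.
have /(filter_forall _) GC j : G (~` A j).
  by have [GAj|//] := in_ultra_setVsetC (A j) GU; case: nA; exists j.
by have [x [[j Ajx]]] := filter_ex (filterI GA GC) => /(_ j).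
Qed.

Section LocalField.
Context {Fq : finFieldType} {red : F -> Fq}.
Hypothesis cv : vcomplete v.
Hypothesis hred : residue_map v red.

Lemma redB {x y} : vring v x -> vring v y -> red (x - y) = red x - red y.
Proof.
case: hred => _ rD _ _ _ xO yO.
by rewrite -[in RHS](subrK y x) [in RHS]rD ?addrK //; exact: (vgeB hv).
Qed.

Lemma red_eq {x y} : vring v x -> vring v y ->
  (red x = red y <-> vge v 1 (x - y)).
Proof.
move=> xO yO; case: hred => _ _ _ _ <-; last exact: (vgeB hv).
by rewrite redB //; split=> [->|/subr0_eq//]; rewrite subrr.
Qed.

(** A ball is the union of finitely many balls of the next radius, one for each vector of residue
    digits, so the ultrafilter selects one of them. *)
Lemma vge_ultra_ball (m : int) (n : nat) (G : set_system L) :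
  UltraFilter G -> G (vge w m) -> exists x, G (vball w x (m + n)).
Proof.
move=> GU Gm; have [d [z [zO _ sz]]] := residual_basis_exists.
have /choice[lift liftP] : forall c, exists a, vring v a /\ red a = c.
  by move=> c; case: hred => _ _ _ /(_ c)[a aO <-] _; exists a.
elim: n => [|n [x Gx]].
  by exists 0; apply: filterS Gm => x; rewrite /vball /= addr0 subr0.
pose A (c : {ffun 'I_d -> Fq}) : set L :=
  vball w (x + varpi ^ (m + n) * \sum_i lift (c i) *: z i) (m + n.+1).
suff /(ultra_finite_cover GU)[c Gc] : G [set y | exists c, A c y].
  by exists (x + varpi ^ (m + n) * \sum_i lift (c i) *: z i).
apply: filterS Gx => y hy.
have yO : vring w (varpi ^ (- (m + n)) * (y - x)).
  by rewrite /vring -[X in vge w X](addNr (m + n)); apply/(vge_uniformizer hw _ _ hvarpi).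
have [a aO ha] := sz _ yO.
exists [ffun i => red (a i)]; rewrite /A /vball /=.
have -> : m + n.+1 = (m + n) + 1%N by lia.
under eq_bigr do rewrite ffunE.
have -> : y - (x + varpi ^ (m + n) * \sum_i lift (red (a i)) *: z i) =
    varpi ^ (m + n) * (varpi ^ (- (m + n)) * (y - x) - \sum_i lift (red (a i)) *: z i).
  rewrite [RHS]mulrBr mulrA -expfzDr ?(proj1 hvarpi) // subrr expr0z mul1r.
  by rewrite opprD addrA.
apply/(vge_uniformizer hw _ _ hvarpi).
rewrite -(subrK (\sum_i a i *: z i) (varpi ^ _ * _)) -addrA; apply: (vgeD hw ha).
rewrite -sumrB; apply: (vge_sum hw) => i _; rewrite -scalerBl.
apply: (vgeW (_ : 1%N%:Z <= e%:Z * 1 + 0)); first by case: he; lia.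
apply: vgeZ (zO i); apply/red_eq; [exact: aO|exact: (liftP _).1|].
by rewrite (liftP _).2.
Qed.

(** The centres of the balls selected by an ultrafilter form a Cauchy sequence, and the ultrafilter
    converges to its limit. The radii advance by e so that successive differences are powers of [pi]
    times elements of the ideal, as [extension_series] requires. *)
Lemma compact_vge (m : int) : compact (vge w m : set (vtop w)).
Proof.
rewrite compact_ultra => G GU Gm.
have [d [z [zO fz sz]]] := residual_basis_exists.
have /choice[x hx] (n : nat) : exists x, G (vball w x (m + (e * n)%N)).
  exact: vge_ultra_ball.
have meet (A B : set L) : G A -> G B -> exists y, A y /\ B y.
  by move=> GA GB; have [y] := filter_ex (filterI GA GB); exists y.
have step n : vge w (m + (e * n)%N) (x n.+1 - x n).
  have [y []] := meet _ _ (hx n) (hx n.+1); rewrite /vball /= => h1 h2.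
  rewrite (_ : _ - _ = (y - x n) - (y - x n.+1)); last by ring.
  by apply: (vgeB hw h1); apply: vgeW h2; nia.
(* The centres are rewritten as partial sums of a [pi]-adic series with integral terms, normalized
   by [varpi ^ (- m)]. *)
pose y n := pi ^- n *: (varpi ^ (- m) * (x n.+1 - x n)).
have yO n : vring w (y n).
  apply/(@vge_scale_unif n); rewrite scalerA mulfV ?scale1r; last first.
    by rewrite expf_neq0 // (proj1 hpi).
  rewrite addr0; apply/(vge_uniformizer hw m _ hvarpi).
  by rewrite mulrA -expfzDr ?(proj1 hvarpi) // subrr expr0z mul1r; exact: step.
have [l lO hl] := extension_series cv (integral_basis_vring zO)
  (integral_basis_spanning sz) y yO.
have sumE N : \sum_(n < N) pi ^+ n *: y n = varpi ^ (- m) * (x N - x 0%N).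
  elim: N => [|N IH]; first by rewrite big_ord0 subrr mulr0.
  rewrite big_ord_recr /= IH /y scalerA mulfV ?scale1r; last first.
    by rewrite expf_neq0 // (proj1 hpi).
  by rewrite -mulrDr addrC; congr (_ * _); ring.
pose p := x 0%N + varpi ^ m * l.
have near_p (N : nat) : vge w (m + (e * N)%N) (p - x N).
  have -> : p - x N = varpi ^ m * (l - \sum_(n < N) pi ^+ n *: y n).
    rewrite sumE mulrBr mulrA -expfzDr ?(proj1 hvarpi) // subrr expr0z mul1r /p.
    by ring.
  exact/(vge_uniformizer hw _ _ hvarpi).
exists p; split.
  have [t [tm]] := meet _ _ Gm (hx 0%N); rewrite /vball /= muln0 addr0 => tx.
  have := near_p 0%N; rewrite muln0 addr0 => px.
  rewrite (_ : p = t - (t - x 0%N) + (p - x 0%N)); last by ring.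
  exact: (vgeD hw (vgeB hw tm tx) px).
move=> A; rewrite (nbhsE (p : vtop w)) => -[U [oU Up] UA].
have [n hn] := oU p Up.
have [N hN] : exists N : nat, n <= m + (e * N)%N.
  by exists `|n - m|%N; case: he; nia.
apply: filterS (hx N) => t ht; apply/UA/hn; rewrite /vball /=.
apply: vgeW hN _; rewrite (_ : t - p = (t - x N) - (p - x N)); last by ring.
exact: (vgeB hw ht (near_p N)).
Qed.

Lemma valuation_automorphism (s : L -> L) :
  (forall x y, s (x + y) = s x + s y) -> (forall x y, s (x * y) = s x * s y) ->
  (forall a x, s (a *: x) = a *: s x) -> s 1 = 1 ->
  forall x, w (s x) = w x.
Proof.
have [d [z [zO fz sz]]] := residual_basis_exists.
exact: (valuation_automorphism_of_basis cv (integral_basis_vring zO)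
  (integral_basis_spanning sz)).
Qed.

(** The map [pr] takes the residue digits of [varpi ^ (- m) * x] in a residual basis of d elements.
    The products of that basis with the first e powers of [varpi] form an integral basis, whence d e
    = [L : F]. *)
Lemma residue_quotient : exists2 d : nat, (d * e)%N = \dim {:L} &
  forall m : int, exists pr : L -> 'rV[Fq]_d,
  [/\ forall x y, vge w m x -> vge w m y -> pr (x + y) = pr x + pr y,
      forall a x, vring v a -> vge w m x -> pr (a *: x) = red a *: pr x,
      forall c, exists2 x, vge w m x & pr x = c
    & forall x, vge w m x -> (pr x = 0 <-> vge w (m + 1) x)].
Proof.
have [d [z [zO fz sz]]] := residual_basis_exists; exists d.
  rewrite -(card_integral_basis cv (integral_basis_vring zO)
    (integral_basis_free zO fz) (integral_basis_spanning sz)).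
  by rewrite card_prod !card_ord mulnC.
case: hred => r1 rD rM rS r0.
move=> m; pose lc (a : 'I_d -> F) := varpi ^ m * \sum_i a i *: z i.
have lcD a b : lc a + lc b = lc (fun i => a i + b i).
  by rewrite /lc -mulrDr -big_split; under [in RHS]eq_bigr do rewrite scalerDl.
have lcB a b : lc a - lc b = lc (fun i => a i - b i).
  by rewrite /lc -mulrBr -sumrB; under [in RHS]eq_bigr do rewrite scalerBl.
have lcZ c a : c *: lc a = lc (fun i => c * a i).
  by rewrite /lc scalerAr scaler_sumr; under [in RHS]eq_bigr do rewrite -scalerA.
have lc_free a : (forall i, vring v (a i)) ->
    (vge w (m + 1) (lc a) <-> forall i, vge v 1 (a i)).
  move=> aO; rewrite (vge_uniformizer hw _ _ hvarpi); split; first exact: fz.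
  move=> a1; apply: (vge_sum hw) => i _.
  apply: (vgeW (_ : 1 <= e%:Z * 1 + 0)); first by case: he; lia.
  exact: vgeZ (a1 i) (zO i).
have /choice[co coP] (x : L) : exists a, vge w m x ->
    (forall i, vring v (a i)) /\ vge w (m + 1) (x - lc a).
  have [xm|] := pselect (vge w m x); last by exists (fun=> 0).
  have xO : vring w (varpi ^ (- m) * x).
    by rewrite /vring -[X in vge w X](addNr m); apply/(vge_uniformizer hw _ _ hvarpi).
  have [a aO ha] := sz _ xO; exists a => _; split=> //.
  move: ha; rewrite -(vge_uniformizer hw m _ hvarpi) mulrBr mulrA.
  by rewrite -expfzDr ?(proj1 hvarpi) // subrr expr0z mul1r.
pose pr x := \row_i red (co x i).
(* Any integral digits approximating x to order m + 1 compute [pr x]; this makes the choice of [co]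
   harmless and yields linearity. *)
have prE x a : vge w m x -> (forall i, vring v (a i)) ->
    vge w (m + 1) (x - lc a) -> pr x = \row_i red (a i).
  move=> /coP[cO hc] aO ha; apply/rowP => i; rewrite !mxE.
  apply/red_eq; rewrite ?cO //; move: i; apply/lc_free.
    by move=> i; exact: (vgeB hv (cO i) (aO i)).
  rewrite -lcB (_ : _ - _ = (x - lc a) - (x - lc (co x))); last by ring.
  exact: (vgeB hw).
exists pr; split.
- move=> x y xm ym; have [xO hx] := coP x xm; have [yO hy] := coP y ym.
  rewrite (prE _ (fun i => co x i + co y i)).
  + by apply/rowP => i; rewrite !mxE rD.
  + exact: (vgeD hw).
  + by move=> i; exact: (vgeD hv (xO i) (yO i)).
  + rewrite -lcD (_ : _ - _ = (x - lc (co x)) + (y - lc (co y))); last by ring.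
    exact: (vgeD hw).
- move=> a x aO xm; have [xO hx] := coP x xm.
  rewrite (prE _ (fun i => a * co x i)).
  + by apply/rowP => i; rewrite !mxE rM.
  + by have := vgeZ aO xm; rewrite mulr0 add0r.
  + by move=> i; have := vgeM hv aO (xO i); rewrite addr0.
  + rewrite -lcZ -scalerBr.
    by have := vgeZ aO hx; rewrite mulr0 add0r.
- move=> c; have /choice[a ha] i : exists a, vring v a /\ red a = c 0 i.
    by have [a] := rS (c 0 i); exists a.
  have aO i : vring v (a i) := (ha i).1.
  have lcm : vge w m (lc a).
    rewrite -[X in vge w X]addr0; apply/(vge_uniformizer hw _ _ hvarpi).
    exact: sum_vring.
  exists (lc a) => //; rewrite (prE _ a) ?subrr //; last by left.
  by apply/rowP => i; rewrite mxE (ha i).2.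
- move=> x xm; have [xO hx] := coP x xm.
  have -> : pr x = 0 <-> forall i, vge v 1 (co x i).
    split=> [/rowP h i|h]; first by apply/(r0 _ (xO i)); have := h i; rewrite !mxE.
    by apply/rowP => i; rewrite !mxE; apply/r0.
  rewrite -lc_free //; split=> h.
    by rewrite -(subrK (lc (co x)) x); exact: (vgeD hw).
  by rewrite (_ : lc _ = x - (x - lc (co x))); [exact: (vgeB hw) | ring].
Qed.

End LocalField.

End Extensions.

(** * Traces *)

Section Trace.
Context {F : fieldType} {L : fieldExtType F}.

Lemma ext_traceD (x y : L) : ext_trace (x + y) = ext_trace x + ext_trace y.
Proof.
by rewrite /ext_trace -big_split; apply: eq_bigr => i _; rewrite mulrDl linearD.
Qed.

Lemma ext_traceZ a (x : L) : ext_trace (a *: x) = a * ext_trace x.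
Proof.
by rewrite /ext_trace mulr_sumr; apply: eq_bigr => i _; rewrite -scalerAl linearZ.
Qed.

Lemma ext_traceN (x : L) : ext_trace (- x) = - ext_trace x.
Proof. by rewrite -scaleN1r ext_traceZ mulN1r. Qed.

(* A resolution of the identity [x = sum_i c_i(x) z_i] computes the trace even *)
(* when [z] is not known to be free. *)
Lemma ext_trace_resolution (I : finType) (z : I -> L) (c : I -> L -> F) (x : L) :
  (forall i a s t, c i (a *: s + t) = a * c i s + c i t) ->
  (forall y, y = \sum_i c i y *: z i) ->
  ext_trace x = \sum_i c i (x * z i).
Proof.
move=> cL cz; rewrite /ext_trace.
have c0 i : c i 0 = 0.
  by have /eqP := cL i 1 0 0; rewrite scale1r addr0 mul1r -subr_eq0 opprD addNKr 
    oppr_eq0 => /eqP.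
have cZ i a s : c i (a *: s) = a * c i s.
  by have := cL i a s 0; rewrite !addr0 c0 addr0.
have cD i s t : c i (s + t) = c i s + c i t.
  by have := cL i 1 s t; rewrite scale1r mul1r.
set X := vbasis _.
have XE y : y = \sum_j coord X j y *: X`_j.
  exact/coord_vbasis/memvf.
under eq_bigr => j _ do rewrite {1}[X`_j]cz mulr_sumr linear_sum.
under [RHS]eq_bigr => i _ do rewrite [x * z i]XE (big_morph (c i) (cD i) (c0 i)).
rewrite exchange_big /=; apply: eq_bigr => i _; apply: eq_bigr => j _.
by rewrite cZ -scalerAr linearZ /= mulrC.
Qed.

End Trace.

(** Transitivity of the trace: the products of the two bases, with iterated coordinates, resolve the
    identity of [k2] over [k]. *)
Lemma ext_trace_base (k : fieldType) (k1 : fieldExtType k) (k2 : fieldExtType k1)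
    (x : k2) :
  ext_trace (x : baseFieldType k2) = ext_trace (ext_trace x).
Proof.
pose X1 := vbasis {:k1}; pose X2 := vbasis {:k2}.
pose I : finType := ('I_(\dim {:k1}) * 'I_(\dim {:k2}))%type.
pose z (ij : I) : baseFieldType k2 := X1`_ij.1 *: (X2`_ij.2 : k2).
pose c (ij : I) (y : baseFieldType k2) := coord X1 ij.1 (coord X2 ij.2 (y : k2)).
rewrite (@ext_trace_resolution _ _ I z c).
- rewrite -(pair_bigA _ (fun i j => c (i, j) (x * z (i, j)))) /= /ext_trace.
  apply: eq_bigr => i _; rewrite mulr_suml linear_sum /=; apply: eq_bigr => j _.
  by rewrite /c /z /= -scalerAr linearZ /= mulrC.
- move=> [i j] a s t; rewrite /c /=.
  rewrite -[coord X2 j (a *: s + t)]/(coord X2 j (a%:A *: (s : k2) + (t : k2))).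
  by rewrite linearP /= mulr_algl linearP.
- move=> y; rewrite -(pair_bigA _ (fun i j => c (i, j) y *: z (i, j))) /= exchange_big /=.
  rewrite [LHS](coord_vbasis (memvf (y : k2))); apply: eq_bigr => j _.
  rewrite {1}[coord _ _ _](coord_vbasis (memvf _)) scaler_suml.
  apply: eq_bigr => i _.
  by rewrite /c /z /= baseField_scaleE scalerA mulr_algl.
Qed.

Lemma ext_trace1 (F : fieldType) (L : fieldExtType F) :
  ext_trace (1 : L) = (\dim {:L})%:R.
Proof.
rewrite /ext_trace -[in RHS](card_ord (\dim {:L})) -sum1_card natr_sum.
apply: eq_bigr => i _.
by rewrite mul1r coord_free ?eqxx // (basis_free (vbasisP _)).
Qed.

(** * Quadratic extensions described by a generator of trace zero *)

Section Quadratic.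
Context {F : fieldType} {L : fieldExtType F} {tau : {lrmorphism L -> L}} {u : L}.
Hypothesis two_neq0 : 2 != 0 :> F.
Hypothesis dimL : \dim {:L} = 2%N.
Hypothesis tau_neq_id : exists x, tau x <> x.
Hypothesis u_neq0 : u <> 0.
Hypothesis tr_u : ext_trace u = 0.

Lemma ext_trace_alg a : ext_trace (a%:A : L) = 2 * a.
Proof. by rewrite ext_traceZ ext_trace1 dimL mulrC. Qed.

Let X := [tuple u; 1].

(** A scalar a has trace 2 a, so away from characteristic 2 a nonzero element of trace 0 is not a
    scalar. *)
Lemma trace0_basis : basis_of {:L} X.
Proof.
rewrite basisEfree subvf dimL leqnn !andbT free_cons seq1_free oner_eq0 andbT.
rewrite span_seq1; apply/vlineP => -[a ua].
move: tr_u; rewrite ua ext_trace_alg => /eqP; rewrite mulf_eq0 (negPf two_neq0) /=.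
by move=> /eqP a0; apply: u_neq0; rewrite ua a0 scale0r.
Qed.

Lemma trace0_decomp (x : L) : exists a b, x = a%:A + b *: u.
Proof.
exists (coord X (lift ord0 ord0) x), (coord X ord0 x).
rewrite {1}(coord_basis trace0_basis (memvf x)).
by rewrite big_ord_recl big_ord1 /= addrC.
Qed.

(** If u u = a + b u, multiplication by u has diagonal entries b and 0 in the basis (u, 1), so the
    trace of u is b. *)
Lemma trace0_sqr : exists a, u * u = a%:A.
Proof.
have fX := basis_free trace0_basis.
have c01 : coord X ord0 1 = 0 := coord_free (lift ord0 ord0) ord0 fX.
have c00 : coord X ord0 u = 1 := coord_free ord0 ord0 fX.
have c10 : coord X (lift ord0 ord0) u = 0 := coord_free ord0 (lift ord0 ord0) fX.
have [a [b uu]] := trace0_decomp (u * u); exists a.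
suff b0 : b = 0 by rewrite uu b0 scale0r addr0.
move: tr_u; rewrite (@ext_trace_resolution _ _ _ (fun i : 'I_2 => X`_i) (coord X)).
- rewrite big_ord_recl big_ord1 /= mulr1 uu linearD !linearZ /=.
  by rewrite c01 c00 c10 mulr0 mulr1 add0r addr0.
- by move=> i c s t; rewrite linearP.
- by move=> y; exact: (coord_basis trace0_basis (memvf y)).
Qed.

(** Since u u is a scalar, [tau u] is u or -u; the first would make [tau] the identity. *)
Lemma tau_trace0 : tau u = - u.
Proof.
have [a uu] := trace0_sqr.
have tuu : tau (u * u) = u * u by rewrite uu linearZ /= rmorph1.
have /eqP : tau u * tau u = u * u by rewrite -rmorphM.
rewrite -!expr2 eqf_sqr => /orP[/eqP tu|/eqP//].
have [x] := tau_neq_id; have [b [c ->]] := trace0_decomp x.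
by rewrite linearD !linearZ /= rmorph1 tu.
Qed.

Lemma tau_decomp a b : tau (a%:A + b *: u) = a%:A - b *: u.
Proof. by rewrite linearD !linearZ /= rmorph1 tau_trace0 scalerN. Qed.

Lemma tauK (x : L) : tau (tau x) = x.
Proof.
have [a [b ->]] := trace0_decomp x.
by rewrite tau_decomp -scaleNr tau_decomp scaleNr opprK.
Qed.

Lemma ext_trace_tau (x : L) : (ext_trace x)%:A = x + tau x.
Proof.
have [a [b ->]] := trace0_decomp x.
rewrite ext_traceD ext_traceZ tr_u mulr0 addr0 ext_trace_alg.
rewrite tau_decomp addrACA subrr addr0.
by rewrite -scalerDl -mulr2n mulr_natl.
Qed.

End Quadratic.

(** The different only records the inverse of the codifferent, so the latter has to be recovered. It
    lies in the ideal of index -delta because [varpi ^ delta] is in the different; equality follows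
    once it contains an element of valuation exactly -delta, since it is a module over the integers
    of [L]. *)
Lemma codifferent_vge (F : fieldType) (L : fieldExtType F) (v : F -> int)
    (w : L -> int) (varpi : L) (delta : int) :
  normalized_valuation w -> uniformizer w varpi ->
  different v w = pideal w varpi delta -> codifferent v w = vge w (- delta).
Proof.
move=> hw hvarpi; rewrite (pideal_vge hw _ hvarpi) => hdiff.
have diffE y : different v w y <-> vge w delta y by rewrite hdiff.
have co_ge x : codifferent v w x -> vge w (- delta) x.
  have /diffE h : vge w delta (varpi ^ delta).
    by right; rewrite (val_uniformizerX hw _ hvarpi).
  by move=> /h; rewrite /vring -[X in vge w X](subrr delta) => /(vge_uniformizer hw _ _ hvarpi).
(* n measures how far an element of the codifferent lies above the bound -delta. If no n occurred,
   or if the least one were positive, the different would contain a power of [varpi] with exponent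
   below delta. *)
pose P n := `[< exists x, [/\ x != 0, codifferent v w x & w x = - delta + n%:Z] >].
have /ex_minnP[n /asboolP[x0 [x00 co0 wx0]] nmin] : exists n, P n.
  apply: contrapT => nP.
  have: different v w (varpi ^ (delta - 1)).
    move=> x cox; have [->|x_neq0] := eqVneq x 0; first by rewrite mulr0; left.
    case: nP; exists `|(w x + delta)%R|%N; apply/asboolP; exists x; split=> //.
    by have /(vge_neq0 x_neq0) := co_ge x cox; lia.
  move=> /diffE /(vge_neq0 (uniformizerX_neq0 _ hvarpi)).
  by rewrite (val_uniformizerX hw _ hvarpi); lia.
have n0 : n = 0%N.
  have /diffE : different v w (varpi ^ (delta - n%:Z)).
    move=> x cox; rewrite /vring -[X in vge w X](subrr (delta - n%:Z)).
    apply/(vge_uniformizer hw _ _ hvarpi).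
    have [->|x_neq0] := eqVneq x 0; first by left.
    have /(vge_neq0 x_neq0) wx := co_ge x cox; right.
    have := nmin `|(w x + delta)%R|%N; suff -> : P `|(w x + delta)%R|%N.
      by move=> /(_ isT); lia.
    by apply/asboolP; exists x; split=> //; lia.
  move=> /(vge_neq0 (uniformizerX_neq0 _ hvarpi)).
  by rewrite (val_uniformizerX hw _ hvarpi); lia.
apply/seteqP; split=> [//|x hx] y yO.
rewrite -[x](mulfVK x00) [_ * x0]mulrC -mulrA; apply: co0.
have hq : vring w (x / x0).
  rewrite /vring -[X in vge w X](addrN (- delta)); apply: (vgeM hw hx).
  by right; rewrite (valuationV hw) // wx0 n0; lia.
by have := vgeM hw hq yO; rewrite addr0.
Qed.

Lemma skew_form_exists (F : fieldType) (V : vectType F) (g : V -> V -> F) :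
  (forall a x y z, g (a *: x + y) z = a * g x z + g y z) ->
  (forall x y, g x y = - g y x) ->
  exists f : {skew_symmetric V}, forall x y, f x y = g x y.
Proof.
move=> gl gN.
have gr a x y z : g z (a *: x + y) = a * g z x + g z y.
  by rewrite gN gl opprD -mulrN -!gN.
have gbil : bilinear_for (GRing.Scale.Law.clone _ _ *%R _)
    (GRing.Scale.Law.clone _ _ (idfun \; *%R) _) g by split=> [z|z] a x y /=.
have gherm x y : g x y = (-1) ^+ true * idfun (g y x) by rewrite expr1 mulN1r.
pose gB := bilinear_isBilinear.Build F V V F _ _ g gbil.
pose gH := isHermitianSesquilinear.Build F V true idfun g gherm.
pose f : {skew_symmetric V} := HB.pack g gB gH.
by exists f.
Qed.

(** * The lattices of the torus *)

(** As p is not 2, the residue of 2 is nonzero, so 2 is a unit of the integers. *)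
Lemma residue_val2 {k : fieldType} {v : k -> int} {Fq : finFieldType}
    {red : k -> Fq} {p : nat} :
  normalized_valuation v -> residue_map v red -> p \in [pchar Fq] -> p <> 2%N ->
  2 != 0 :> k /\ v 2 = 0.
Proof.
move=> hv [r1 rD _ _ r0] hp p2.
have O1 := vring1 hv; have O2 : vring v 2 := vgeD hv O1 O1.
have red2 : red 2 <> 0.
  rewrite (rD 1 1) // r1 => /eqP h.
  have : 2%N \in [pchar Fq] by rewrite inE /= -mulr2n in h *.
  by rewrite (pcharf_eq hp) inE => /eqP /esym.
have n2 : ~ vge v 1 2 by move=> /(r0 _ O2).
have two0 : 2 != 0 :> k by apply/eqP => h; apply: n2; left.
split=> //; move: O2 n2; rewrite /vring !(vge_neq0 two0); lia.
Qed.

Section Torus.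
Context {k : fieldType} {v : k -> int} {Fq : finFieldType} {red : k -> Fq}.
Context {varpi : k} {lambda : int}.
Context {k1 : fieldExtType k} {v1 : k1 -> int} { pi1 : k1} {e : nat} {delta : int}.
Context {k2 : fieldExtType k1} {v2 : k2 -> int} { pi2 : k2} {e2 : nat}.
Context {tau : {lrmorphism k2 -> k2}} {u : k2}.
Local Notation W := (baseFieldType k2).
Hypothesis hv : normalized_valuation v.
Hypothesis cv : vcomplete v.
Hypothesis hred : residue_map v red.
Hypothesis hpi : uniformizer v varpi.
Hypothesis two_neq0 : 2 != 0 :> k.
Hypothesis val2 : v 2 = 0.
Hypothesis hv1 : normalized_valuation v1.
Hypothesis hpi1 : uniformizer v1 pi1.
Hypothesis he : ramification_index v v1 e.
Hypothesis hdelta : different v v1 = pideal v1 pi1 delta.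
Hypothesis hk2 : \dim {:k2} = 2%N.
Hypothesis hv2 : normalized_valuation v2.
Hypothesis hpi2 : uniformizer v2 pi2.
Hypothesis he2 : ramification_index v1 v2 e2.
Hypothesis htau : exists x, tau x <> x.
Hypothesis hu0 : u <> 0.
Hypothesis hutr : ext_trace u = 0.

Lemma normalized_valuation_base : normalized_valuation (v2 : W -> int).
Proof. exact: hv2. Qed.

Lemma uniformizer_base : uniformizer (v2 : W -> int) pi2.
Proof. exact: hpi2. Qed.

Lemma ramification_index_base :
  ramification_index v (v2 : W -> int) (e * e2)%N.
Proof.
split=> [|a a0]; first by rewrite muln_gt0 (proj1 he) (proj1 he2).
have a1 : a%:A != 0 :> k1 by rewrite scaler_eq0 oner_eq0 orbF.
rewrite -[v2 _]/(v2 (a%:A%:A)) (proj2 he2) // (proj2 he) //.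
by rewrite PoszM mulrCA mulrA.
Qed.

Lemma dim_base : \dim {:W} = (2 * \dim {:k1})%N.
Proof.
rewrite -hk2 -dim_baseVspace; congr (\dim _); apply/vspaceP => x.
by rewrite mem_baseVspace memvf (@memvf _ k2).
Qed.

(** Completeness is assumed for [k], so [k2] is regarded as an extension of [k] and [tau] as a
    [k]-linear automorphism. *)
Lemma val_tau x : v2 (tau x) = v2 x.
Proof.
apply: (valuation_automorphism hv normalized_valuation_base ramification_index_base
  hpi uniformizer_base cv (tau : W -> W)).
- exact: (rmorphD tau).
- exact: (rmorphM tau).
- by move=> a y; rewrite !baseField_scaleE linearZ.
- exact: (rmorph1 tau).
Qed.

Let two_neq0_k1 : 2 != 0 :> k1.
Proof. by rewrite -(rmorph_nat (in_alg k1)) fmorph_eq0. Qed.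

Let val2_k1 : v1 2 = 0.
Proof. by rewrite -(rmorph_nat (in_alg k1)) /= (proj2 he) // val2 mulr0. Qed.

Let traceE := ext_trace_tau two_neq0_k1 hk2 htau hu0 hutr.

(* Tameness enters through [v 2 = 0]: the trace of [1] is a unit. *)
Lemma quadratic_codifferent (n : int) (z : k2) :
  (forall y, vring v2 y -> vge v1 n (ext_trace (z * y))) <->
  vge v2 (e2%:Z * n + 1 - e2%:Z) z.
Proof.
have e2_gt0 := proj1 he2; split=> [h|hz y yO].
  have [->|z0] := eqVneq z 0; first by left.
  apply/(vge_neq0 z0); rewrite leNgt; apply/negP => vz.
  have p0 := uniformizerX_neq0 (n - 1) hpi1.
  have pA0 : (pi1 ^ (n - 1))%:A != 0 :> k2 by rewrite scaler_eq0 oner_eq0 orbF.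
  (* If z had too small a valuation, this test element would be integral; its product with z is
     [pi1 ^ (n - 1)], whose trace has valuation n - 1 because 2 is a unit. *)
  have /h : vring v2 (z^-1 * (pi1 ^ (n - 1))%:A).
    right; rewrite (valuationM hv2) ?invr_eq0 // (valuationV hv2) //.
    by rewrite (proj2 he2) // (val_uniformizerX hv1 _ hpi1); nia.
  rewrite mulrA mulfV // mul1r ext_traceZ ext_trace1 hk2 mulrC.
  rewrite (vge_neq0 (mulf_neq0 two_neq0_k1 p0)) (valuationM hv1) // val2_k1.
  by rewrite (val_uniformizerX hv1 _ hpi1); lia.
have [t0|t0] := eqVneq (ext_trace (z * y)) 0; first by left.
apply/(vge_neq0 t0).
have zy : vge v2 (e2%:Z * n + 1 - e2%:Z) (z * y).
  by have := vgeM hv2 hz yO; rewrite addr0.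
have tzy : vge v2 (e2%:Z * n + 1 - e2%:Z) (tau (z * y)).
  have [->|zy0] := eqVneq (z * y) 0; first by rewrite rmorph0; left.
  by right; rewrite val_tau; apply/(vge_neq0 zy0).
(* The trace is z y plus its conjugate, of v2-valuation greater than e2 (n - 1). On [k1] this
   valuation is a multiple of e2, so [v1] of the trace is at least n. *)
have := vgeD hv2 zy tzy; rewrite -traceE.
have tA0 : (ext_trace (z * y))%:A != 0 :> k2 by rewrite scaler_eq0 oner_eq0 orbF.
by rewrite (vge_neq0 tA0) (proj2 he2) //; nia.
Qed.

(** Multiplying t by [varpi ^ (- lambda)] turns the condition into membership in the codifferent. *)
Lemma trace_codifferent (t : k1) :
  (forall a, vring v1 a -> vge v lambda (ext_trace (t * a))) <->
  vge v1 (e%:Z * lambda - delta) t.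
Proof.
have hco := codifferent_vge _ _ _ _ _ _ hv1 hpi1 hdelta.
have p0 : (varpi ^ (- lambda))%:A != 0 :> k1.
  by rewrite scaler_eq0 oner_eq0 orbF (uniformizerX_neq0 _ hpi).
have vp : v1 (varpi ^ (- lambda))%:A = e%:Z * (- lambda).
  by rewrite (proj2 he) ?(uniformizerX_neq0 _ hpi) // (val_uniformizerX hv _ hpi).
rewrite -(vge_mull hv1 p0) vp.
have -> : e%:Z * - lambda + (e%:Z * lambda - delta) = - delta by ring.
rewrite -hco /codifferent /=.
split=> h a /h; rewrite mulr_algl -scalerAl ext_traceZ /vring.
  by rewrite -[X in _ -> vge v X _](addNr lambda); move/(vge_uniformizer hv _ _ hpi).
by rewrite -[X in vge v X _ -> _](addNr lambda); move/(vge_uniformizer hv _ _ hpi).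
Qed.

(** The factor 1/2 is a unit, and writing y as [pi2 ^ m] times an integer moves the ideal into s =
    pi2^m u tau(x). The two codifferent lemmas then bound the valuation of s, which is m + v2 u + v2
    x. *)
Lemma dual_vge (m : int) :
  dual_lattice v varpi lambda (beta tau u) (vge v2 m) =
  vge v2 (e2%:Z * (e%:Z * lambda - delta) + 1 - e2%:Z - v2 u - m).
Proof.
have u0 : u != 0 by exact/eqP.
apply/seteqP; rewrite /dual_lattice (pideal_vge hv _ hpi).
suff main x : (forall y : W, vge v2 m y -> vge v lambda (beta tau u x y)) <->
    vge v2 (e2%:Z * (e%:Z * lambda - delta) + 1 - e2%:Z - v2 u - m) x.
  by split=> x /main.
have half y : vge v lambda (beta tau u x y) <->
    vge v lambda (ext_trace (ext_trace (u * tau x * y))).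
  rewrite /beta ext_trace_base -{1}[lambda]add0r.
  have -> : 0 = v 2^-1 by rewrite (valuationV hv) // val2 oppr0.
  by apply: (vge_mull hv); rewrite invr_eq0.
have [x_eq0|x0] := eqVneq x 0.
  split=> _; first by rewrite x_eq0; left.
  move=> y _; apply/half; rewrite x_eq0 rmorph0 mulr0 mul0r.
  rewrite -(scale0r (0 : k2)) ext_traceZ mul0r -(scale0r (0 : k1)).
  by rewrite ext_traceZ mul0r; left.
have tx0 : tau x != 0 by rewrite fmorph_eq0.
pose s := pi2 ^ m * (u * tau x).
have sv : vge v2 (e2%:Z * (e%:Z * lambda - delta) + 1 - e2%:Z) s <->
    vge v2 (e2%:Z * (e%:Z * lambda - delta) + 1 - e2%:Z - v2 u - m) x.
  rewrite /s (vge_neq0 x0) vge_neq0; last first.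
    by rewrite !mulf_neq0 // (uniformizerX_neq0 _ hpi2).
  rewrite !(valuationM hv2) ?mulf_neq0 ?(uniformizerX_neq0 _ hpi2) // val_tau.
  by rewrite (val_uniformizerX hv2 _ hpi2); lia.
rewrite -sv -quadratic_codifferent; split=> h y.
  (* Integers a of [k1] may be absorbed into y because the ideal is stable under them; this supplies
     the quantifier over a in [trace_codifferent]. *)
  move=> yO; apply/trace_codifferent => a aO.
  have ym : vge v2 m (a *: (pi2 ^ m * y)).
    have := vgeZ hv2 he2 aO (_ : vge v2 m (pi2 ^ m * y)); rewrite mulr0 add0r; apply.
    by rewrite -[X in vge v2 X]addr0; apply/(vge_uniformizer hv2 _ _ hpi2).
  have /half := h _ ym; rewrite -scalerAr ext_traceZ mulrC.
  by rewrite mulrCA -/s mulrA.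
move=> ym; apply/half.
have yO : vring v2 (pi2 ^ (- m) * y).
  by rewrite /vring -[X in vge v2 X](addNr m); apply/(vge_uniformizer hv2 _ _ hpi2).
have /trace_codifferent/(_ 1 (vring1 hv1)) := h _ yO; rewrite mulr1.
rewrite /s mulrACA -expfzDr ?(proj1 hpi2) // subrr expr0z mul1r.
exact.
Qed.

Lemma beta_linearr a (x y z : W) :
  beta tau u x (a *: y + z) = a * beta tau u x y + beta tau u x z.
Proof.
rewrite /beta -[u * tau x * _]/((u * tau x : W) * (a *: y + z)) mulrDr -scalerAr.
by rewrite ext_traceD ext_traceZ mulrDr mulrCA.
Qed.

(** Since [tau u = - u], conjugation turns u tau(x) y into minus u tau(y) x, and the trace to [k1]
    is invariant under conjugation. *)
Lemma beta_skew (x y : W) : beta tau u x y = - beta tau u y x.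
Proof.
rewrite /beta !ext_trace_base -mulrN -ext_traceN; congr (_ * ext_trace _).
apply: (fmorph_inj (in_alg k2)); rewrite /= scaleNr !traceE.
have tauM (a c : k2) : tau (a * c) = tau a * tau c by exact: rmorphM.
rewrite !tauM.
rewrite (tau_trace0 two_neq0_k1 hk2 htau hu0 hutr).
rewrite !(tauK two_neq0_k1 hk2 htau hu0 hutr).
by ring.
Qed.

Lemma lattice_vge (m : int) : lattice v v2 (vge v2 m).
Proof.
split.
- split; [exact: vge0 | exact: (@vgeD _ _ hv2) | move=> a x aO xm].
  have := vgeZ normalized_valuation_base ramification_index_base aO xm.
  by rewrite mulr0 add0r.
- exact: (compact_vge hv normalized_valuation_base ramification_index_base hpi
    uniformizer_base cv hred).
- move=> x xm; exists m => y; rewrite /vball /= => yx.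
  by rewrite -(subrK x y); exact: (vgeD hv2).
Qed.

(** As [tau] preserves the valuation, t tau(t) = 1 forces 2 v2(t) = 0. *)
Lemma torus_vge (m : int) (t x : k2) :
  torus tau t -> vge v2 m x -> vge v2 m (t * x).
Proof.
move=> tt1 xm.
have t0 : t != 0.
  by apply: contra_eq_neq tt1 => ->; rewrite mul0r eq_sym oner_eq0.
suff vt : v2 t = 0 by rewrite -[m]add0r -vt; apply/(vge_mull hv2).
have := valuationM hv2 t0 (_ : tau t != 0); rewrite tt1 (valuation1 hv2) val_tau.
rewrite fmorph_eq0 => /(_ t0)/esym/eqP.
by rewrite -mulr2n mulrn_eq0 => /eqP.
Qed.

Let M : int := e2%:Z * (e%:Z * lambda - delta) + 1 - e2%:Z - v2 u.

Lemma good_vge (m : int) : M <= m + m -> m + m <= M + (e * e2)%N%:Z ->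
  good_lattice v v2 varpi lambda (beta tau u) (vge v2 m).
Proof.
move=> hM1 hM2; split; first exact: lattice_vge.
  move=> _ [x + <-]; rewrite dual_vge -/M => hx.
  have varpi1 : vge v 1 varpi by right; rewrite (proj2 hpi).
  have := vgeZ normalized_valuation_base ramification_index_base varpi1 hx.
  by apply: vgeW; lia.
by rewrite dual_vge -/M => x; apply: vgeW; lia.
Qed.

Lemma symplectic_quotient (s : int) : s + s + 1 = M ->
  let b := beta tau u in
  exists (V : vectType Fq) (pr : W -> V),
  [/\ quotient_map v red (vge v2 s) (vge v2 (s + 1)) pr,
      (\dim {:V} * (e * e2) = 2 * \dim {:k1})%N
    & exists f : {skew_symmetric V},
      (nondegenerate f) /\
      forall x y, vge v2 s x -> vge v2 s y ->
        vring v (varpi ^ (1 - lambda) * b x y) /\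
        f (pr x) (pr y) = red (varpi ^ (1 - lambda) * b x y)].
Proof.
move=> sM b.
have [d dE hpr] := residue_quotient hv normalized_valuation_base
  ramification_index_base hpi uniformizer_base cv hred.
pose A : set W := vge v2 s; pose A1 : set W := vge v2 (s + 1).
have AD (x y : W) : A x -> A y -> A (x + y) := @vgeD _ _ hv2 s x y.
have AB (x y : W) : A x -> A y -> A (x - y) := @vgeB _ _ hv2 s x y.
have AZ a (x : W) : vring v a -> A x -> A (a *: x).
  move=> aO xA; have := vgeZ normalized_valuation_base ramification_index_base aO xA.
  by rewrite mulr0 add0r.
have A1Z (x : W) : A x -> A1 (varpi *: x).
  have varpi1 : vge v 1 varpi by right; rewrite (proj2 hpi).
  move=> xA; have := vgeZ normalized_valuation_base ramification_index_base varpi1 xA.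
  by apply: vgeW; case: ramification_index_base => E_gt0 _; lia.
have [pr prQ] : exists pr : W -> 'rV[Fq]_d, quotient_map v red A A1 pr := hpr s.
exists 'rV[Fq]_d, pr; split; first exact: prQ.
  by rewrite dimvf /dim /= mul1n dE dim_base.
have [prD prZ prS pr0] := prQ.
have dual_A : dual_lattice v varpi lambda b A = A1.
  by rewrite /A dual_vge -/M /A1; congr vge; lia.
have dual_A1 : dual_lattice v varpi lambda b A1 = A.
  by rewrite /A1 dual_vge -/M /A; congr vge; lia.
(* From here on only the module properties of the two ideals and their mutual duality are
   retained. *)
rewrite -/A; move: A A1 AD AB AZ A1Z prQ prD prZ prS pr0 dual_A dual_A1.
move=> A A1 AD AB AZ A1Z _ prD prZ prS pr0 dual_A dual_A1.
pose q (x y : W) := varpi ^ (1 - lambda) * b x y.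
have qN x y : q x y = - q y x by rewrite /q /b beta_skew mulrN.
have qr a (x y z : W) : q x (a *: y + z) = a * q x y + q x z.
  by rewrite /q /b beta_linearr mulrDr mulrCA.
have q0 x : q x 0 = 0.
  have /eqP := qr 1 x 0 0; rewrite scale1r addr0 mul1r -subr_eq0 opprD addNKr.
  by rewrite oppr_eq0 => /eqP.
have q_unif x y : vge v 1 (q x y) <-> vge v lambda (b x y).
  rewrite /q -[X in vge v X _ <-> _](subrK lambda).
  exact: (vge_uniformizer hv _ _ hpi).
have q1 (x y : W) : A x -> A1 y -> vge v 1 (q x y).
  by rewrite -dual_A1 /dual_lattice /= (pideal_vge hv _ hpi) => h /h /q_unif.
have qO (x y : W) : A x -> A y -> vring v (q x y).
  (* As [varpi *: y] lies in [A1], the value varpi q(x, y) has valuation at least 1, hence q(x, y)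
     is integral. *)
  move=> xs /A1Z ys; have := q1 _ _ xs ys.
  rewrite -[varpi *: y]addr0 qr q0 addr0 -{1}[varpi]expr1z -{1}[1]addr0.
  by move/(vge_uniformizer hv _ _ hpi).
have prB x y : A x -> A y -> pr (x - y) = pr x - pr y.
  move=> xs ys; have h := AB _ _ xs ys.
  by rewrite -[in RHS](subrK y x) [in RHS]prD // addrK.
have q_pr x y y' : A x -> A y -> A y' -> pr y = pr y' -> red (q x y) = red (q x y').
  move=> xs ys ys' eqpr; apply/(red_eq hv hred); [exact: qO|exact: qO|].
  have -> : q x y - q x y' = q x (y - y').
    by rewrite [y - y']addrC -scaleN1r qr mulN1r addrC.
  apply: q1 => //; apply/pr0; first exact: AB.
  by rewrite prB // eqpr subrr.
have /choice[sec secP] c : exists x, A x /\ pr x = c.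
  by have [x] := prS c; exists x.
have secA c : A (sec c) := (secP c).1.
have secK c : pr (sec c) = c := (secP c).2.
have redN x : vring v x -> red (- x) = - red x.
  have [_ _ _ _ r0] := hred.
  have red0 : red 0 = 0 by apply/r0; left.
  by move=> xO; rewrite -sub0r (redB hv hred) // ?red0 ?sub0r //; left.
pose g a c := red (q (sec a) (sec c)).
(* Independence of the representative is known in the second variable; skew-symmetry carries it to
   the first. *)
have gE x y : A x -> A y -> g (pr x) (pr y) = red (q x y).
  move=> xs ys; rewrite /g (q_pr _ _ y) ?secK // qN redN; last exact: qO.
  by rewrite (q_pr _ _ x) ?secK // [in RHS]qN redN //; exact: qO.
have gN a c : g a c = - g c a by rewrite /g qN redN //; exact: qO.
have gl a x y z : g (a *: x + y) z = a * g x z + g y z.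
  have [r1 rD rM rS _] := hred; have [l lO <-] := rS a.
  rewrite gN -[in LHS](secK x) -[in LHS](secK y) -[in LHS](secK z) -prZ //.
  have ls := AZ _ _ lO (secA x).
  have qz t : vring v (q (sec z) (sec t)) by exact: qO.
  rewrite -prD // gE //; last exact: AD.
  have lq : vring v (l * q (sec z) (sec x)).
    by have := vgeM hv lO (qz x); rewrite addr0.
  by rewrite qr rD // rM // opprD -mulrN -!gN.
have [f fE] := skew_form_exists _ _ g gl gN.
exists f; split; last by move=> x y xs ys; split; [exact: qO | rewrite fE gE].
(* A lift of a vector orthogonal to everything pairs with [A] into the maximal ideal, so it lies in
   the dual of [A], which is the kernel of [pr] on [A]. *)
rewrite /nondegenerate -subv0; apply/subvP => c /mem_orthovP hc.
rewrite memv0 -(secK c); apply/eqP/pr0 => //.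
rewrite -dual_A /dual_lattice /= (pideal_vge hv _ hpi) => y ys.
apply/q_unif; have [_ _ _ _ r0] := hred; apply/r0; first exact: qO.
by rewrite -gE // -fE secK; apply: hc; exact: memvf.
Qed.

End Torus.

(** * The lattice B: index computations and the symplectic quotient *)

Theorem mainTheorem13
  (R : realType)
  (k : fieldType) (v : k -> int) (Fq : finFieldType) (red : k -> Fq) (pi : k)
  (p : nat) (psi : k -> R[i]) (lambda : int)
  (k1 : fieldExtType k) (v1 : k1 -> int) (pi1 : k1) (r e : nat) (delta : int)
  (k2 : fieldExtType k1) (v2 : k2 -> int) (pi2 : k2) (e2 : nat)
  (tau : {lrmorphism k2 -> k2}) (u : k2)
  (hk : local_field_char0 v red)
  (hpi : uniformizer v pi)
  (hp : p \in [pchar Fq]) (hp2 : p <> 2%N)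
  (hpsi : unitary_character v psi) (hpsi1 : exists x, psi x <> 1)
  (hlambda : conductor v pi psi lambda)
  (hr : \dim {:k1} = r)
  (hv1 : normalized_valuation v1) (hpi1 : uniformizer v1 pi1)
  (he : ramification_index v v1 e)
  (hdelta : different v v1 = pideal v1 pi1 delta)
  (hk2 : \dim {:k2} = 2%N)
  (hv2 : normalized_valuation v2) (hpi2 : uniformizer v2 pi2)
  (he2 : ramification_index v1 v2 e2)
  (htau : exists x, tau x <> x)
  (hpi12 : if e2 == 1%N then pi2 = pi1%:A else pi2 ^+ 2 = pi1%:A)
  (hu0 : u <> 0) (hutr : ext_trace u = 0)
  (hu : if e2 == 1%N then v2 u = 0 \/ v2 u = 1 else u = pi2) :
  let ramified := e2 != 1%N in
  let mu : int := e%:Z * lambda - delta - v2 u in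
  let b := beta tau u in
  let B := torus_lattice v2 pi1 pi2 ramified mu in
  let Bstar := dual_lattice v pi lambda b B in
  [/\ good_lattice v v2 pi lambda b B,
      (forall t x, torus tau t -> B x -> B (t * x)),
      (B = Bstar <-> ramified \/ (2 %| mu)%Z)
    & ~~ ramified -> ~~ (2 %| mu)%Z ->
      Bstar = [set pi1%:A^-1 * x | x in B] /\
      exists (V : vectType Fq) (pr : baseFieldType k2 -> V),
        [/\ quotient_map v red Bstar B pr,
            (\dim {:V})%:R = (2 * r)%:R / e%:R :> rat,
            (exists n : int,
              [/\ [set pi1%:A ^ n * x | x in vring v2] = Bstar,
                  [set pi1%:A ^ n * x | x in pideal v2 pi1%:A 1] = B
                & quotient_map v red (vring v2 : set (baseFieldType k2))
                    (pideal v2 pi1%:A 1)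
                    (fun x => pr (pi1%:A ^ n * x)) ])
          & exists f : {skew_symmetric V},
              is_psymplectic f /\
              forall x y, Bstar x -> Bstar y ->
                vring v (pi ^ (1 - lambda) * b x y) /\
                f (pr x) (pr y) = red (pi ^ (1 - lambda) * b x y)]].
Proof.
move=> ramified mu b B Bstar.
have [_ hv cv hred] := hk.
have [two0 val2] := residue_val2 hv hred hp hp2.
have u0 : u != 0 by exact/eqP.
have e_gt0 := proj1 he.
have v2pi1 : v2 (pi1%:A) = e2.
  by rewrite (proj2 he2) ?(proj1 hpi1) // (proj2 hpi1) mulr1.
(* In the ramified case [pi2 ^+ 2 = pi1%:A] has valuation both 2 and e2, and u is [pi2]. *)
have e2_cases : if ramified then e2 = 2%N /\ v2 u = 1 else e2 = 1%N.
  rewrite /ramified; move: hpi12 hu; case: eqP => //= e2N1 pi22 uE.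
  move: v2pi1; rewrite uE (proj2 hpi2) -pi22 (valuationXn hv2) ?(proj1 hpi2) //.
  by rewrite (proj2 hpi2); lia.
pose m := if ramified then mu else ((mu + 1) %/ 2)%Z.
pose M := e2%:Z * (e%:Z * lambda - delta) + 1 - e2%:Z - v2 u.
have pi1_unif : ~~ ramified -> uniformizer v2 (pi1%:A).
  move: e2_cases; case: ifP => // _ e21 _; split; last by rewrite v2pi1 e21.
  by rewrite scaler_eq0 oner_eq0 orbF (proj1 hpi1).
have BE : B = vge v2 m.
  rewrite /B /torus_lattice /m; case: ifPn => [_|/pi1_unif h]; exact: pideal_vge.
have dualE n : dual_lattice v pi lambda b (vge v2 n) = vge v2 (M - n).
  exact: (dual_vge hv cv hpi two0 val2 hv1 hpi1 he hdelta hk2 hv2 hpi2 he2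
    htau hu0 hutr).
have BstarE : Bstar = vge v2 (M - m) by rewrite /Bstar BE dualE.
(* The whole dichotomy: M = 2 m is self-duality, while M + 1 = 2 m puts B one step below its
   dual. *)
have MmE : if ramified || (2 %| mu)%Z then M = m + m else M + 1 = m + m.
  rewrite /M /m /mu; move: e2_cases; rewrite -/mu.
  case: ifP => _ [] /=; first by move=> -> vu; rewrite /mu; lia.
  by move=> ->; case: ifP; rewrite /mu; lia.
have vge_eq i j : vge v2 i = vge v2 j -> i = j.
  have sub i' j' : vge v2 i' `<=` vge v2 j' -> j' <= i'.
    move=> /(_ (pi2 ^ i')); rewrite !(vge_neq0 (uniformizerX_neq0 _ hpi2)).
    by rewrite (val_uniformizerX hv2 _ hpi2) => /(_ (lexx _)).
  by move=> h; apply/eqP; rewrite eq_le !sub // h.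
split.
- rewrite BE; apply: (good_vge hv cv hred hpi two0 val2 hv1 hpi1 he hdelta hk2
    hv2 hpi2 he2 htau hu0 hutr); rewrite -/M; move: MmE; case: ifP => _;
    have := proj1 he2; nia.
- move=> t x; rewrite BE; exact: (torus_vge hv cv hpi he hv2 hpi2 he2).
- rewrite BE BstarE; split=> [/vge_eq h|h].
    by apply/orP; apply: contraT => /negPf nram; move: MmE; rewrite nram; lia.
  by move: MmE; move/orP: h => -> ME; congr vge; lia.
move=> nram nmu; have e21 : e2 = 1%N by move: e2_cases; rewrite (negPf nram).
have pi1u := pi1_unif nram; have pA0 := proj1 pi1u.
have ME : M + 1 = m + m by move: MmE; rewrite (negPf nram) (negPf nmu).
(* The index of the dual of B; multiplication by [pi1 ^ s] is also the identification with the
   integers of [k2] modulo [pi1]. *)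
pose s := M - m.
have sE : s + s + 1 = M by rewrite /s; lia.
have BE' : B = vge v2 (s + 1) by rewrite BE; congr vge; rewrite /s; lia.
have scaled n i : [set pi1%:A ^ n * x | x in vge v2 i] = vge v2 (n + i).
  apply/seteqP; split=> [_ [x xi <-]|x xi].
    exact/(vge_uniformizer hv2 _ _ pi1u).
  exists (pi1%:A ^ (- n) * x); last first.
    by rewrite mulrA -expfzDr // subrr expr0z mul1r.
  by rewrite -(addKr n i); apply/(vge_uniformizer hv2 _ _ pi1u).
rewrite BstarE -/s; split.
  by rewrite BE' -[pi1%:A^-1]exprN1 scaled; congr vge; lia.
have [V [pr [prQ dimV [f [fnd fE]]]]] := symplectic_quotient hv cv hred hpi two0 val2
  hv1 hpi1 he hdelta hk2 hv2 hpi2 he2 htau hu0 hutr s sE.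
exists V, pr; split.
- by rewrite BE'; exact: prQ.
- move: dimV; rewrite e21 muln1 hr => dimV.
  have e0 : e%:R != 0 :> rat by rewrite pnatr_eq0 -lt0n.
  by apply: (mulIf e0); rewrite mulfVK // -natrM dimV.
- exists s; split.
  + by rewrite /vring scaled addr0.
  + by rewrite (pideal_vge hv2 _ pi1u) scaled BE'.
  have [prD prZ prS pr0] := prQ.
  have sO (x : k2) : vring v2 x -> vge v2 s (pi1%:A ^ s * x).
    by move=> xO; rewrite -[X in vge v2 X]addr0; apply/(vge_uniformizer hv2 _ _ pi1u).
  rewrite (pideal_vge hv2 _ pi1u); split.
  + by move=> x y /sO xs /sO ys; rewrite mulrDr prD.
  + by move=> a x aO /sO xs; rewrite -scalerAr prZ.
  + move=> c; have [x xs <-] := prS c.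
    exists (pi1%:A ^ (- s) * x); last by rewrite mulrA -expfzDr // subrr expr0z mul1r.
    by rewrite /vring -(addNr s); apply/(vge_uniformizer hv2 _ _ pi1u).
  + move=> x /sO xs; rewrite (pr0 _ xs); exact: (vge_uniformizer hv2 _ _ pi1u).
exists f; split; last exact: fE.
(* The remaining clause of [is_psymplectic] concerns characteristic 2, which p excludes. *)
split=> // two_char; case: hp2.
by move: two_char; rewrite (pcharf_eq hp) inE => /eqP/esym.
Qed.
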